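(* Let $X$ and $Y$ be Banach spaces with $X$ separable, let $B:X\to Y$ be a surjective bounded linear operator, and let $U\subseteq X$ be a closed subspace such that the restriction $A:=B|_U:U\to Y$ is injective and has range $\mathcal{R}(A)$ dense in $Y$. Then the range $\mathcal{R}(A)$ is closed in $Y$ if and only if $U$ is a complement of the null-space $\mathcal{N}(B)$ in $X$.
   Context: $\mathcal{N}(B)$ denotes the null-space (kernel) of $B$ and $\mathcal{R}(A)$ the range of $A$. A complement of a closed subspace $V$ of a Banach space $X$ is a closed subspace $U\subseteq X$ such that $U\cap V=\{0\}$ and $U+V=X$. *)

(* Defs.v *)
From HB Require Import structures.
From mathcomp Require Import all_boot all_order all_algebra.
From mathcomp Require Import all_classical all_reals all_analysis.

Set Implicit Arguments.
Unset Strict Implicit.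
Unset Printing Implicit Defensive.

Import Order.TTheory GRing.Theory Num.Theory.
Import numFieldNormedType.Exports.

Local Open Scope classical_set_scope.
Local Open Scope ring_scope.

Definition separable_space (T : topologicalType) : Prop :=
  exists2 D : set T, countable D & dense D.

(* For scalars [K = R[i]] norms take their values in [K]; the inequality then
   forces the bound [M] to be real as soon as [X] is nonzero. *)
Definition bounded_operator (K : numFieldType) (X Y : normedModType K)
    (f : X -> Y) : Prop :=
  exists M : K, forall x, `|f x| <= M * `|x|.

Definition closed_subspace (K : numFieldType) (X : normedModType K)
    (V : set X) : Prop :=
  closed V /\ submod_closed (mem V).

Definition null_space (K : numFieldType) (X Y : normedModType K)
    (f : X -> Y) : set X := f @^-1` [set 0].

(* [V] is meant to be a closed subspace; this is not required here, since it is
   automatic for the null-space of a bounded operator. *)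
Definition is_complement (K : numFieldType) (X : normedModType K)
    (V U : set X) : Prop :=
  [/\ closed_subspace U,
      U `&` V = [set 0]
    & [set u + v | u in U & v in V] = [set: X]].

(* Main.v *)
Require Import Defs.
From HB Require Import structures.
From mathcomp Require Import all_boot all_order all_algebra.
From mathcomp Require Import all_classical all_reals all_analysis.

Set Implicit Arguments.
Unset Strict Implicit.
Unset Printing Implicit Defensive.

Import Order.TTheory GRing.Theory Num.Theory.
Import numFieldNormedType.Exports.

Local Open Scope classical_set_scope.
Local Open Scope ring_scope.

(** As a closed dense subset of [Y] is all of [Y], the range of the restriction
    [A] of [B] to [U] is closed exactly when [B] already maps [U] onto [Y].
    This surjectivity is a purely algebraic reformulation of [U + N(B) = X]: if
    [B u = B x] then [x - u] lies in the kernel, and conversely adding a kernel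
    vector to [u] does not change [B u], so [B U = B X = Y] ([image_fullP]).
    The remaining condition [U] meets [N(B)] only in [0] is the injectivity of
    [A] ([sub_null_space_trivial]). *)

Lemma closed_denseP (T : topologicalType) (S : set T) :
  dense S -> closed S <-> S = [set: T].
Proof.
move=> dS; split=> [cS|->]; last exact: closedT.
apply: contrapT => /eqP/setTPn S'0.
by have [x []] := dS _ S'0 (closed_openC cS).
Qed.

Section LinearImages.
Variables (K : numFieldType) (X Y : normedModType K) (B : {linear X -> Y}).

(** Two points have the same image under [B] exactly when they differ by a
    kernel vector, so [U + N(B)] is the preimage of [B U]. *)
Lemma image_fullP (U : set X) : set_surj [set: X] [set: Y] B ->
  B @` U = [set: Y] <-> [set u + v | u in U & v in null_space B] = [set: X].
Proof.
move=> surjB; split=> [BU|UN]; rewrite -subTset.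
  move=> x _; have [u Uu Bu] : (B @` U) (B x) by rewrite BU.
  exists u => //; exists (x - u); last by rewrite addrC subrK.
  by rewrite /null_space /= linearB Bu subrr.
move=> y /surjB[x _ <-].
have [u Uu [v Bv <-]] : [set u + v | u in U & v in null_space B] x by rewrite UN.
by exists u => //; rewrite linearD Bv addr0.
Qed.

Lemma sub_null_space_trivial (U : set X) :
  U 0 -> {in U &, injective B} -> U `&` null_space B = [set 0].
Proof.
move=> U0 injB; apply/seteqP; split=> [x [Ux Bx]|_ ->]; last first.
  by split=> //; rewrite /null_space /= linear0.
by apply: injB; rewrite ?inE // Bx linear0.
Qed.

End LinearImages.

Theorem proposition5 (K : numFieldType) (X Y : completeNormedModType K)
    (sepX : separable_space X)
    (B : {linear X -> Y}) (bndB : bounded_operator B)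
    (surjB : set_surj [set: X] [set: Y] B)
    (U : set X) (subU : closed_subspace U) :
  let A : U -> Y := sigL U B in
  injective A -> dense (range A) ->
  (closed (range A) <-> is_complement (null_space B) U).
Proof.
move=> A /sigL_injP injB dA.
have rA : range A = B @` U.
  apply/seteqP; split=> [_ [u _ <-]|_ [u Uu <-]].
    by exists (val u) => //; exact: set_valP.
  by exists (SigSub (mem_set Uu)).
rewrite (closed_denseP dA) rA (image_fullP _ surjB).
have U0 : U 0 by have [_ [/set_mem]] := subU.
split=> [UN|[]//]; split=> //.
exact: sub_null_space_trivial.
Qed.
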